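(* Every normal quadratic congruence can be obtained by the projection construction. Precisely: let $n\ge 3$, $V$ a complex vector space of dimension $n$, $C_0$ a quadric of a hyperplane of $\mathbb{P}(V)$, $W_0\subset S^2V^*$ the $(n+1)$-dimensional space of equations of quadrics of $\mathbb{P}(V)$ containing $C_0$, and $\sigma:\mathbb{P}(V)\dashrightarrow\mathbb{P}(W_0)$ any quadratic congruence. Then there exist a complex vector space $W$ of dimension $n+1$, an isomorphism $\phi:W\to W^*$ with $Q(\phi)$ of rank at least $3$, a smooth point $O$ of $Q(\phi)$, a hyperplane $\mathbb{P}_{n-1}$ of $\mathbb{P}(W)$ not containing $O$, and a projective isomorphism $\mathbb{P}_{n-1}\simeq\mathbb{P}(V)$ under which $C_0=\pi(Q(\phi)\cap T_O)$ and $\sigma(Q)=S({}^\bot\eta(Q))$ for general $Q\in\mathbb{P}_{n-1}$.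
   Context: A quadratic congruence with values in $\mathbb{P}(W_0)$ ($W_0\subset S^2V^*$ of dimension $n+1$) is a rational map $\sigma:\mathbb{P}(V)\dashrightarrow\mathbb{P}(W_0)$ such that: (1) $\sigma^*(\mathcal{O}(1))=\mathcal{O}(2)$; (2) $\sigma^*:W_0^*\to H^0(\mathbb{P}(V),\mathcal{O}(2))=S^2V^*$ induces an isomorphism $W_0^*\simeq W_0$, also denoted $\sigma^*$; (3) $P\in\sigma(P)$ for every point $P$ of $\mathbb{P}(V)$ where $\sigma$ is defined, $\sigma(P)$ being viewed as a quadric of $\mathbb{P}(V)$. It is normal if $W_0$ is the space of equations of all quadrics of $\mathbb{P}(V)$ containing a quadric of some hyperplane of $\mathbb{P}(V)$. Construction. Given an isomorphism $\phi:W\to W^*$ that is not antisymmetric, $Q(\phi)$ is the quadric $x.\phi(x)=0$ of $\mathbb{P}(W)$; its rank is that of $\frac12(\phi+{}^t\phi)$. For $X\subset\mathbb{P}(W)$, ${}^\bot X$ is the linear subspace of points $y$ with $y.\phi(x)=0$ for all $x\in X$. For $O$ a smooth point of $Q(\phi)$, $T_O$ is the tangent hyperplane to $Q(\phi)$ at $O$; $\mathbb{P}_{n-1}\subset\mathbb{P}(W)$ is a hyperplane not containing $O$, and $\pi:\mathbb{P}(W)\setminus\{O\}\to\mathbb{P}_{n-1}$ is the projection from $O$; $\pi(Q(\phi)\cap T_O)$ is a quadric of the hyperplane $\pi(T_O)$ of $\mathbb{P}_{n-1}$. For $Q\in\mathbb{P}_{n-1}$ not on this quadric, $\eta(Q)$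 is the point other than $O$ common to the line $OQ$ and $Q(\phi)$, i.e. $\eta(Q)=(Q.\phi(Q))O-(Q.\phi(O)+O.\phi(Q))Q$. For a hyperplane $\Pi$ of $\mathbb{P}(W)$ with linear equation $h$, $S(\Pi)$ is the quadric $\pi(Q(\phi)\cap\Pi)$ of $\mathbb{P}_{n-1}$, i.e. the quadric of equation $h\circ\eta=0$; it contains $\pi(Q(\phi)\cap T_O)$.
   Formalization: The formal theorem also assumes that the isomorphism σ^*: W_0^* → W_0 is not antisymmetric; for antisymmetric σ^* (possible when n is odd) the claim fails, since φ would be antisymmetric and Q(φ) would have rank 0. *)

(* Defs.v *)
From HB Require Import structures.
From mathcomp Require Import all_boot all_order all_algebra.
From mathcomp Require Export complex.
From mathcomp Require Export reals.

Set Implicit Arguments.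
Unset Strict Implicit.
Unset Printing Implicit Defensive.

Import GRing.Theory.
Local Open Scope ring_scope.

(* The definitions are used only over K = R[i] with R : realType.  They rely on
   K being infinite (polynomials are identified with polynomial functions) and
   of characteristic 0 (polarization). *)
Section Definitions.
Variable K : fieldType.
Implicit Types V E W : vectType K.

Definition dual V : vectType K := 'Hom(V, K^o).

(* Bilinear forms, curried.  A linear map phi : W -> W^* is the same object;
   the pairing x.phi(y) of the point x with the linear form phi(y) is
   [phi y x]. *)
Definition bform V : vectType K := 'Hom(V, dual V).

Definition bapp V (b : bform V) (u v : V) : K :=
  ((b : 'Hom(V, dual V)) u : 'Hom(V, K^o)) v.

(* S^2 V^* is the space of symmetric elements of [bform V]; the quadratic
   polynomial attached to b is v |-> b(v, v). *)
Definition symmetric_form V (b : bform V) : Prop :=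
  forall u v, bapp b u v = bapp b v u.

Definition quad V (b : bform V) (v : V) : K := bapp b v v.

(* Two equations define the same quadric (with its multiplicity structure). *)
Definition same_quadric V (f g : V -> K) : Prop :=
  exists2 c : K, c != 0 & forall v, f v = c * g v.

(* Coordinate-free homogeneous polynomial maps of degree d: the restrictions
   to the diagonal of d-multilinear maps. *)
Definition set_arg d V (x : {ffun 'I_d -> V}) (i : 'I_d) (u : V) :
  {ffun 'I_d -> V} := [ffun j => if j == i then u else x j].

Definition multilinear d V E (m : {ffun 'I_d -> V} -> E) : Prop :=
  forall x i a u v,
    m (set_arg x i (a *: u + v)) = a *: m (set_arg x i u) + m (set_arg x i v).

Definition homog_map d V E (s : V -> E) : Prop :=
  exists2 m : {ffun 'I_d -> V} -> E, multilinear m &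
    forall v, s v = m [ffun=> v].

(* A property of points of P(E) (given on nonzero vectors) holds for a general
   point when it holds on the complement of a hypersurface. *)
Definition generically E (T : E -> Prop) : Prop :=
  exists (d : nat) (f : E -> K^o),
    [/\ homog_map d f, exists x, f x != 0 &
        forall x, x != 0 -> f x != 0 -> T x].

(* A rational map P(V) --> P(E), given by its reduced representative: a nonzero
   homogeneous polynomial map whose components have no common factor of
   positive degree.  Every rational map has such a representative, unique up to
   a nonzero scalar; the map is defined exactly at the points where the
   representative does not vanish, and O(1) pulls back to O(d) where d is the
   degree of the representative. *)
Record ratmap V E := RatMap {
  rm_deg : nat;
  rm_fun :> V -> E;
  rm_homog : homog_map rm_deg rm_fun;
  rm_nonzero : exists v, rm_fun v != 0;
  rm_reduced : forall (d e : nat) (f : V -> K^o) (t : V -> E),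
    (d + e)%N = rm_deg -> homog_map d f -> homog_map e t ->
    (forall v, rm_fun v = f v *: t v) -> d = 0%N
}.

Section Congruence.
Variables (V : vectType K) (W0 : {vspace bform V}).
Variable sigma : ratmap V (subvs_of W0).

(* theta is the map W0^* -> W0 induced by sigma^*, i.e. by l |-> l o sigma. *)
Definition is_pullback (theta : 'Hom(dual (subvs_of W0), subvs_of W0)) : Prop :=
  forall (l : 'Hom(subvs_of W0, K^o)) v, quad (vsval (theta l)) v = l (sigma v).

Record quadratic_congruence : Prop := QuadraticCongruence {
  qc_symmetric : forall b, b \in W0 -> symmetric_form b;
  qc_dim : \dim W0 = (\dim {:V}).+1;
  qc_degree : rm_deg sigma = 2;
  qc_iso : exists2 theta, is_pullback theta & bijective theta;
  qc_incident : forall v, sigma v != 0 -> quad (vsval (sigma v)) v = 0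
}.

(* sigma^* : W0^* -> W0 is antisymmetric, W0 being identified with its bidual.
   Then qc_incident holds automatically, and sigma does not come from an
   isomorphism phi for which Q(phi) is a quadric. *)
Definition antisymmetric_pullback : Prop :=
  exists2 theta, is_pullback theta &
    forall l m : 'Hom(subvs_of W0, K^o), l (theta m) = - m (theta l).

End Congruence.

Record hquadric V := HQuadric {
  hq_hyper : {vspace V};
  hq_form : bform (subvs_of hq_hyper);
  hq_dim : (\dim hq_hyper).+1 = \dim {:V};
  hq_symmetric : symmetric_form hq_form;
  hq_nonzero : hq_form != 0
}.

(* The restriction to the hyperplane of the equation b is a multiple of the
   equation of C0 (scheme-theoretic containment: C0 may be a double linear
   space). *)
Definition contains_hquadric V (C0 : hquadric V) (b : bform V) : Prop :=
  exists c : K, forall u : subvs_of (hq_hyper C0),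
    quad b (vsval u) = c * quad (hq_form C0) u.

Definition is_normal_space V (C0 : hquadric V) (W0 : {vspace bform V}) : Prop :=
  forall b, b \in W0 <-> symmetric_form b /\ contains_hquadric C0 b.

Section Construction.
Variables (W : vectType K) (phi : bform W).

Definition transpose_form (x y : W) : K^o := bapp phi y x.

Fact transpose_form_is_linear x : linear (transpose_form x).
Proof.
by move=> a u v; rewrite /transpose_form /bapp linearP /= add_lfunE scale_lfunE.
Qed.

HB.instance Definition _ x := GRing.isLinear.Build K W K^o _
  (transpose_form x) (transpose_form_is_linear x).

Definition transpose_fun (x : W) : dual W := linfun (transpose_form x).

Fact transpose_fun_is_linear : linear transpose_fun.
Proof.
move=> a u v; apply/lfunP => y.
by rewrite add_lfunE scale_lfunE !lfunE /= /transpose_form /bapp linearP.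
Qed.

HB.instance Definition _ := GRing.isLinear.Build K W (dual W) _
  transpose_fun transpose_fun_is_linear.

Definition transpose : bform W := linfun transpose_fun.

Lemma transposeE x y : bapp transpose x y = bapp phi y x.
Proof. by rewrite /bapp lfunE /= lfunE. Qed.

(* Q(phi) is the quadric of equation x.phi(x) = quad phi x; its rank: *)
Definition Q_rank : nat :=
  \dim (limg (2^-1 *: (phi + transpose) : 'Hom(W, dual W))).

(* The differential of x.phi(x) at O, x |-> x.phi(O) + O.phi(x). *)
Definition Q_differential (O : W) : 'Hom(W, K^o) :=
  ((phi + transpose : bform W) : 'Hom(W, dual W)) O.

Definition smooth_point (O : W) : Prop :=
  [/\ O != 0, quad phi O = 0 & Q_differential O != 0].

Definition tangent_hyperplane (O : W) : {vspace W} := lker (Q_differential O).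

(* The linear subspace of the y such that y.phi(x) = 0. *)
Definition perp (x : W) : {vspace W} :=
  lker ((phi : 'Hom(W, dual W)) x : 'Hom(W, K^o)).

Variables (O : W) (P : {vspace W}).

(* The projection from O onto the hyperplane P. *)
Definition proj : 'Hom(W, subvs_of P) :=
  (linfun (vsproj P) \o daddv_pi P <[O]>)%VF.

Definition eta (x : subvs_of P) : W :=
  let y := vsval x in
  quad phi y *: O - (bapp phi O y + bapp phi y O) *: y.

(* f is an equation of the quadric S(Pi) of P. *)
Definition is_S (Pi : {vspace W}) (f : subvs_of P -> K) : Prop :=
  exists h : 'Hom(W, K^o),
    [/\ h != 0, Pi = lker h & same_quadric f (fun x => h (eta x))].

(* iota identifies C0 with pi (Q(phi) :&: T_O): the hyperplane of C0 is
   pi(T_O), and the cone over C0 with vertex O is Q(phi) :&: T_O. *)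
Definition is_projected_tangent_section V (iota : 'Hom(subvs_of P, V))
    (C0 : hquadric V) : Prop :=
  (iota @: (proj @: tangent_hyperplane O))%VS = hq_hyper C0 /\
  same_quadric
    (fun x : subvs_of (tangent_hyperplane O) =>
       quad (hq_form C0) (vsproj (hq_hyper C0) (iota (proj (vsval x)))))
    (fun x => quad phi (vsval x)).

End Construction.

End Definitions.

(* Main.v *)
(* The paper's W is W0^*, with phi the bilinear form l.phi(m) = m(sigma^* l).
   Condition (3) says that the quadric Q(phi) contains all the evaluations
   w |-> w(v).  If h is an equation of the hyperplane of C0 and q a quadratic
   form on V extending the equation of C0, then W0 = h V^* + K q, hence
   W0^* = V + K O, with O vanishing on h V^*, and the evaluation at v is
   h(v) v + q(v) O.  A quadratic form on V + K O vanishing at these points is a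
   multiple of (v, t) |-> h(v) t - q(v), nonzero since sigma^* is not
   antisymmetric.  Hence O is a smooth point of Q(phi), T_O is the cone over
   C0, and eta(v) is proportional to the evaluation at v, so that
   z |-> eta(z).phi(eta(v)) is an equation of the quadric sigma(v). *)

From HB Require Import structures.
Require Import Defs.
From mathcomp Require Import all_boot all_order all_algebra.
From mathcomp Require Import boolp ring zify.

Set Implicit Arguments.
Unset Strict Implicit.
Unset Printing Implicit Defensive.

Import GRing.Theory.
Local Open Scope ring_scope.

(** * Linear maps, duals and equations of hyperplanes *)

Lemma linear_hom (K : fieldType) (U V : vectType K) (f : U -> V) :
  linear f -> exists g : 'Hom(U, V), forall x, g x = f x.
Proof.
move=> f_lin.
pose mF := GRing.isLinear.Build K U V _ f f_lin.
pose F : {linear U -> V} := HB.pack f mF.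
by exists (linfun F) => x; rewrite lfunE.
Qed.

Section LinearMaps.
Variables (K : fieldType) (U V : vectType K).

(** Turns a formula linear in each variable into a map to the dual; [lam], [mu] and [phi] below are
    built this way. *)
Lemma bilinear_hom (B : U -> V -> K^o) :
  (forall y, linear (B^~ y)) -> (forall x, linear (B x)) ->
  exists b : 'Hom(U, dual V), forall x y, (b x : 'Hom(V, K^o)) y = B x y.
Proof.
move=> Bl Br.
pose mF x := GRing.isLinear.Build K V K^o _ (B x) (Br x).
pose F x : {linear V -> K^o} := HB.pack (B x) (mF x).
have F_lin : linear (fun x => linfun (F x) : dual V).
  move=> a x x'; apply/lfunP => y.
  by rewrite add_lfunE scale_lfunE !lfunE /= Bl.
have [b bE] := linear_hom F_lin.
by exists b => x y; rewrite bE lfunE.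
Qed.

Lemma inj_lfun_bij (f : 'Hom(U, V)) :
  \dim {:U} = \dim {:V} -> (forall x, f x = 0 -> x = 0) -> bijective f.
Proof.
move=> dimUV f_inj.
have ker0 : lker f == 0%VS.
  by rewrite -subv0; apply/subvP => x; rewrite memv_ker memv0 => /eqP/f_inj->.
have imf : limg f = {:V}%VS.
  apply/eqP; rewrite eqEdim subvf -dimUV limg_dim_eq /= ?leqnn //.
  by apply/eqP; rewrite -subv0 -(eqP ker0) capvSr.
exists (f^-1)%VF; first exact: lker0_lfunK.
by move=> y; apply: limg_lfunVK; rewrite imf memvf.
Qed.

Lemma dim_dual : \dim {:dual V} = \dim {:V}.
Proof. by rewrite !dimvf /dim /= muln1. Qed.

Lemma dual_separates (x : V) :
  (forall l : 'Hom(V, K^o), l x = 0) -> x = 0.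
Proof.
move=> lx0; rewrite (coord_vbasis (memvf x)) big1 // => i _.
have := lx0 (linfun (coord (vbasis {:V}) i : V -> K^o)).
by rewrite lfunE /= => ->; rewrite scale0r.
Qed.

Lemma dim_lker (h : 'Hom(V, K^o)) (e : V) : h e = 1 ->
  (\dim (lker h)).+1 = \dim {:V}.
Proof.
move=> he; have : (0 < \dim (limg h))%N.
  rewrite lt0n dimv_eq0; apply: contra_eqN he => /eqP im0.
  have := memv_img h (memvf e).
  by rewrite im0 memv0 => /eqP->; rewrite eq_sym oner_eq0.
have : (\dim (limg h) <= 1)%N by rewrite (leq_trans (dimvS (subvf _))) ?dimvf.
by have := limg_ker_dim h {:V}; rewrite capfv; lia.
Qed.

Lemma hyperplane_kernel (H : {vspace V}) : (\dim H).+1 = \dim {:V} ->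
  exists (h : 'Hom(V, K^o)) (e : V), h e = 1 /\ H = lker h.
Proof.
move=> dimH.
have [e eH] : exists e, e \notin H.
  have : ~~ ({:V} <= H)%VS.
    by apply/negP => /dimvS; rewrite -dimH ltnn.
  by case/subvPn => e _ eH; exists e.
have e0 : e != 0 by apply: contraNneq eH => ->; rewrite mem0v.
have capeH : (<[e]> :&: H = 0)%VS.
  apply/eqP; rewrite -subv0; apply/subvP => x.
  rewrite memv_cap memv0 => /andP[/vlineP[k ->] kH].
  rewrite scaler_eq0 (negPf e0) orbF; apply: contraNT eH => k0.
  by have := memvZ k^-1 kH; rewrite scalerA mulVf // scale1r.
(* The equation is the coordinate along [e] of the projection onto the line of [e] parallel to
   [H]. *)
pose h : 'Hom(V, K^o) :=
  (linfun (coord [tuple e] ord0 : V -> K^o) \o daddv_pi <[e]> H)%VF.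
have he : h e = 1.
  rewrite comp_lfunE lfunE /= daddv_pi_id ?memv_line //.
  have fe : free [tuple e] by rewrite /= seq1_free.
  by have := coord_free ord0 ord0 fe; rewrite /= => ->.
exists h, e; split => //; apply/eqP; rewrite eqEdim; apply/andP; split.
  apply/subvP => u uH; rewrite memv_ker.
  have ueH : u \in (<[e]> + H)%VS by apply: (subvP (addvSr _ _)).
  have := daddv_pi_add capeH ueH; rewrite (daddv_pi_id (V := <[e]>)) 1?capvC //.
  move=> /(canRL (addrK _)); rewrite subrr => pi0.
  by rewrite comp_lfunE pi0 linear0.
by rewrite -ltnS dimH (dim_lker he).
Qed.

End LinearMaps.

(** * Bilinear and quadratic forms in characteristic 0 *)

Section BilinearForms.
Variables (K : fieldType) (V : vectType K).
Implicit Types (b : bform V) (u v w : V).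

Lemma bapp_linearl b w : linear ((bapp b)^~ w : V -> K^o).
Proof. by move=> a u v; rewrite /bapp linearP add_lfunE scale_lfunE. Qed.

Lemma bapp_linearr b w : linear (bapp b w : V -> K^o).
Proof. by move=> a u v; rewrite /bapp linearP. Qed.

Lemma bapp_linear u v : linear (fun b => bapp b u v : K^o).
Proof.
by move=> a b c; rewrite /bapp add_lfunE scale_lfunE add_lfunE scale_lfunE.
Qed.

Lemma bappDl b u v w : bapp b (u + v) w = bapp b u w + bapp b v w.
Proof. by have := bapp_linearl b w 1 u v; rewrite !scale1r. Qed.

Lemma bappDr b u v w : bapp b w (u + v) = bapp b w u + bapp b w v.
Proof. by have := bapp_linearr b w 1 u v; rewrite !scale1r. Qed.

Lemma bapp0l b w : bapp b 0 w = 0.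
Proof. by rewrite /bapp linear0 zero_lfunE. Qed.

Lemma bapp0r b w : bapp b w 0 = 0.
Proof. by rewrite /bapp linear0. Qed.

Lemma bappZl b a u w : bapp b (a *: u) w = a * bapp b u w.
Proof. by have := bapp_linearl b w a u 0; rewrite bapp0l !addr0. Qed.

Lemma bappZr b a u w : bapp b w (a *: u) = a * bapp b w u.
Proof. by have := bapp_linearr b w a u 0; rewrite bapp0r !addr0. Qed.

Definition bappE := (bappDl, bappDr, bappZl, bappZr).

Lemma polarE b u v :
  bapp b u v + bapp b v u = quad b (u + v) - quad b u - quad b v.
Proof. by rewrite /quad !bappE; ring. Qed.

Hypothesis char0 : [pchar K] =i pred0.

Lemma two_neq0 : 2 != 0 :> K.
Proof. by rewrite (iffLR (pcharf0P K) char0). Qed.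

Lemma natr_inj : injective (fun i => i%:R : K).
Proof.
have natr0 i : (i%:R == 0 :> K) = (i == 0%N).
  exact: (iffLR (pcharf0P K) char0).
move=> i j /= /eqP eq_ij; wlog le_ij : i j eq_ij / (i <= j)%N => [Hij|].
  case: (leqP i j) => [|/ltnW] le; first exact: Hij.
  by apply/esym/Hij; rewrite // eq_sym.
apply/eqP; rewrite eqn_leq le_ij -subn_eq0 -natr0 natrB //.
by rewrite -(eqP eq_ij) subrr eqxx.
Qed.

Lemma symmetric_quad_eq0 b :
  Defs.symmetric_form b -> (forall u, quad b u = 0) -> b = 0.
Proof.
move=> b_sym b_eq0; apply/lfunP => u; rewrite zero_lfunE.
apply/lfunP => v; rewrite zero_lfunE -/(bapp b u v).
apply: (mulfI two_neq0); rewrite mulr0 -(b_eq0 (u + v)).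
have := b_eq0 u; have := b_eq0 v.
by rewrite /quad !bappE (b_sym v u) => -> ->; ring.
Qed.

Lemma symmetric_quad_neq0 b :
  Defs.symmetric_form b -> b != 0 -> exists u, quad b u != 0.
Proof.
move=> b_sym /eqP b_neq0; apply: contrapT => /forallNP noq.
by apply/b_neq0/symmetric_quad_eq0 => // u; apply/eqP/negPn/negP.
Qed.

(** If l(u) is nonzero, then l(u0) = 0, so l is nonzero at u, u0 + u and u0 - u. Hence b vanishes at
    these three points, and the parallelogram identity gives 2 b(u0) = 0, a contradiction. *)
Lemma quad_mul_linear_eq0 b u0 (l : V -> K^o) : quad b u0 != 0 -> linear l ->
  (forall u, quad b u * l u = 0) -> forall u, l u = 0.
Proof.
move=> b_u0 l_lin bl0 u; apply/eqP/negPn/negP => lu.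
have l_u0 : l u0 = 0 by apply: (mulfI b_u0); rewrite bl0 mulr0.
have b_zero v : l v != 0 -> quad b v = 0.
  by move=> lv; apply: (mulIf lv); rewrite bl0 mul0r.
have b_line a : a != 0 -> quad b (a *: u + u0) = 0.
  by move=> a0; rewrite b_zero // l_lin l_u0 addr0 mulf_neq0.
move/negP: b_u0; apply; apply/eqP/(mulfI two_neq0); rewrite mulr0.
have <- : quad b (1 *: u + u0) + quad b (-1 *: u + u0) - 2 * quad b u
          = 2 * quad b u0 by rewrite /quad !bappE; ring.
by rewrite !b_line ?oppr_eq0 ?oner_neq0 // b_zero // mulr0 addr0 subr0.
Qed.

(** The integers from 0 to [size p] - 1 are distinct in K, one root too many for a nonzero [p]. *)
Lemma poly_all_roots (p : {poly K}) : (forall s, p.[s] = 0) -> p = 0.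
Proof.
move=> p0; apply/eqP/negPn/negP => p_neq0.
have := max_poly_roots (rs := [seq i%:R | i <- iota 0 (size p)]) p_neq0.
rewrite size_map size_iota ltnn (map_inj_uniq natr_inj) iota_uniq.
by move=> /(_ _ isT) H; suff /H : all (root p) [seq i%:R | i <- iota 0 (size p)];
  [|apply/allP => x _; apply/rootP].
Qed.

End BilinearForms.

(** * The model V + K O of the dual of W0, and its evaluation points *)

Section Model.
Variables (K : fieldType) (V : vectType K).
Variables (h : 'Hom(V, K^o)) (e : V) (q : bform (subvs_of (lker h))).
Hypotheses (char0 : [pchar K] =i pred0) (he : h e = 1).
Hypotheses (q_sym : Defs.symmetric_form q) (q_neq0 : q != 0).

Definition model : vectType K := (V * K^o)%type.

(** The extension of [q] to V that is constant along [e]: an equation of the cone with vertex [e]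
    over the quadric q = 0. *)
Definition cone_quad (v : V) : K := quad q (vsproj (lker h) (v - h v *: e)).

(** This parametrizes the quadric h(v) t = q(v); where h(v) is nonzero, it inverts the projection
    from O. *)
Definition evaluation_point (v : V) : model := (h v *: v, cone_quad v).

Lemma kernel_coord (u : subvs_of (lker h)) (s : K) : h (vsval u + s *: e) = s.
Proof.
have /eqP hu : h (vsval u) == 0 by rewrite -memv_ker subvsP.
by rewrite linearD linearZ /= he hu add0r [LHS]mulr1.
Qed.

Lemma kernel_split v : exists u : subvs_of (lker h), v = vsval u + h v *: e.
Proof.
exists (vsproj (lker h) (v - h v *: e)); rewrite vsprojK ?subrK //.
by rewrite memv_ker linearB linearZ /= he [X in _ - X]mulr1 subrr.
Qed.

Lemma cone_quadE (u : subvs_of (lker h)) (s : K) :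
  cone_quad (vsval u + s *: e) = quad q u.
Proof. by rewrite /cone_quad kernel_coord addrK vsvalK. Qed.

(* On [v = u + s e] with [h u = 0], the hypothesis says that a quartic in [s]
   vanishes; its five coefficients determine [phi] up to the factor [c]. *)
Lemma quad_of_evaluation_points (phi : bform model) :
  (forall v, quad phi (evaluation_point v) = 0) ->
  exists c : K, forall x, quad phi x = c * (h x.1 * x.2 - cone_quad x.1).
Proof.
move=> phi0; have [u0 qu0] := symmetric_quad_neq0 char0 q_sym q_neq0.
pose O : model := (0, 1); pose E : model := (e, 0).
pose U (u : subvs_of (lker h)) : model := (vsval u, 0).
pose B x y := bapp phi x y + bapp phi y x.
have quad3 x y z a b c : quad phi (a *: x + b *: y + c *: z) =
    a ^+ 2 * quad phi x + b ^+ 2 * quad phi y + c ^+ 2 * quad phi z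
    + a * b * B x y + a * c * B x z + b * c * B y z.
  by rewrite /B /quad !bappE; ring.
have coefs u : [/\ quad q u ^+ 2 * quad phi O = 0, quad q u * B (U u) O = 0,
    quad phi (U u) + quad q u * B E O = 0, B (U u) E = 0 & quad phi E = 0].
  pose p := Poly [:: quad q u ^+ 2 * quad phi O; quad q u * B (U u) O;
    quad phi (U u) + quad q u * B E O; B (U u) E; quad phi E].
  have p0 : p = 0.
    apply: (poly_all_roots char0) => s; rewrite horner_Poly /=.
    rewrite -[RHS](phi0 (vsval u + s *: e)) /evaluation_point cone_quadE.
    rewrite kernel_coord.
    have -> : (s *: (vsval u + s *: e), quad q u) =
        s *: U u + s ^+ 2 *: E + quad q u *: O :> model.
      congr (_, _) => /=; first by rewrite scaler0 addr0 scalerDr scalerA.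
      by rewrite !scaler0 !add0r; symmetry; apply: mulr1.
    by rewrite quad3; ring.
  have coef i : p`_i = 0 by rewrite p0 coef0.
  split; [have := coef 0%N | have := coef 1%N | have := coef 2%N
    | have := coef 3%N | have := coef 4%N]; by rewrite coef_Poly.
have OO : quad phi O = 0.
  have [/eqP + _ _ _ _] := coefs u0.
  by rewrite mulf_eq0 expf_eq0 (negPf qu0) => /eqP.
(* The coefficient of s only gives q(u) B(U u, O) = 0; since q is not zero, the factor linear in u
   must vanish. *)
have UO : forall u, B (U u) O = 0.
  apply: (quad_mul_linear_eq0 char0 qu0) => [a u v|u]; last first.
    by have [] := coefs u.
  have -> : U (a *: u + v) = a *: U u + U v.
    by congr (_, _) => /=; rewrite ?linearP // scaler0 addr0.
  by rewrite /B !bappE [X in _ = X + _]mulrDr; ring.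
(* What survives is s t B(E, O) and phi(U u) = - q(u) B(E, O), with the common factor B(E, O). *)
exists (B E O) => -[v t] /=; have [u ->] := kernel_split v; set s := h v.
rewrite kernel_coord cone_quadE; have [_ _ UU UE EE] := coefs u.
have -> : (vsval u + s *: e, t) = 1 *: U u + s *: E + t *: O :> model.
  congr (_, _) => /=; first by rewrite scale1r scaler0 addr0.
  by rewrite !scaler0 !add0r; symmetry; apply: mulr1.
rewrite quad3 UE EE OO UO (canRL (addrK _) UU); ring.
Qed.

Lemma dim_model : \dim {:model} = (\dim {:V}).+1.
Proof. by rewrite !dimvf; apply: addn1. Qed.

(* The linear form [w |-> l(v) + t a] on the equations [w = h l + a q]: it is
   determined by [l(v) = 2 w(v, e) - h(v) w(e, e)] and [a = w(u0, u0) / q(u0)].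
   Injectivity in [w] and equality of dimensions give bijectivity. *)
Lemma normal_space_duality (W0 : {vspace bform V}) :
  (forall b, b \in W0 -> Defs.symmetric_form b) ->
  (forall b, b \in W0 -> exists c, forall u : subvs_of (lker h),
     quad b (vsval u) = c * quad q u) ->
  \dim W0 = (\dim {:V}).+1 ->
  exists2 lam : 'Hom(model, dual (subvs_of W0)), bijective lam &
    forall v (w : subvs_of W0),
      (lam (evaluation_point v) : 'Hom(_, K^o)) w = quad (vsval w) v.
Proof.
move=> W0_sym W0_q dimW0.
have [u0 qu0] := symmetric_quad_neq0 char0 q_sym q_neq0.
pose a0 (w : subvs_of W0) := quad (vsval w) (vsval u0) / quad q u0.
pose B (x : model) (w : subvs_of W0) : K^o :=
  2 * bapp (vsval w) x.1 e - h x.1 * bapp (vsval w) e e + x.2 * a0 w.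
have Bl w : linear (B^~ w).
  move=> a x y; rewrite /B /= linearP bappDl bappZl /=.
  by rewrite /GRing.scale /=; ring.
have Br x : linear (B x).
  move=> a w w'; rewrite /B /a0 /quad linearP !bapp_linear.
  by rewrite /GRing.scale /=; ring.
have [lam lamE] := bilinear_hom Bl Br.
have [mu muE] := bilinear_hom (B := fun w x => B x w) Br Bl.
have a0E (w : subvs_of W0) (u : subvs_of (lker h)) :
    quad (vsval w) (vsval u) = a0 w * quad q u.
  have [c cE] := W0_q _ (subvsP w).
  by rewrite /a0 !cE mulfK.
have lam_eval v w :
    (lam (evaluation_point v) : 'Hom(_, K^o)) w = quad (vsval w) v.
  rewrite lamE /B /evaluation_point; have [u ->] := kernel_split v.
  set s := h v; rewrite kernel_coord /=.
  have -> : h (s *: (vsval u + s *: e)) = s * s.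
    by rewrite linearZ /= kernel_coord.
  rewrite cone_quadE [_ * a0 w]mulrC -a0E /quad !bappE.
  rewrite (W0_sym _ (subvsP w) e (vsval u)); ring.
exists lam => //.
(* A form [w] killed by [mu] vanishes at all evaluation points, hence is zero as a quadratic
   form. *)
have mu_bij : bijective mu.
  apply: inj_lfun_bij => [|w mu0].
    by rewrite dim_dual dim_model -dimW0 dimvf.
  have Bw x : B x w = 0 by rewrite -muE mu0 zero_lfunE.
  apply: val_inj; apply: (symmetric_quad_eq0 char0) => [|v].
    exact/W0_sym/subvsP.
  by rewrite /= -lam_eval lamE.
(* Every linear form on the model is some [mu w], so all of them vanish at an [x] killed by
   [lam]. *)
apply: inj_lfun_bij => [|x lam0].
  by rewrite dim_dual dim_model -dimW0 dimvf.
apply: dual_separates => l; have [mu' _ muK] := mu_bij.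
by rewrite -(muK l) muE -lamE lam0 zero_lfunE.
Qed.

(** * The point O, the hyperplane t = 0 and the projection from O *)

Definition apex : model := (0, 1).

Definition base : {vspace model} := lker (linfun (snd : model -> K^o)).

Definition base_iso : 'Hom(subvs_of base, V) :=
  linfun ((fst : model -> V) \o vsval).

Lemma base_isoE x : base_iso x = (vsval x).1.
Proof. by rewrite lfunE. Qed.

Lemma memv_base x : (x \in base) = (x.2 == 0).
Proof. by rewrite memv_ker lfunE. Qed.

Lemma dim_base : \dim base = \dim {:V}.
Proof.
have h1 : linfun (snd : model -> K^o) apex = 1 by rewrite lfunE.
by apply: succn_inj; rewrite (dim_lker h1) dim_model.
Qed.

Lemma apex_notin_base : apex \notin base.
Proof. by rewrite memv_base oner_eq0. Qed.

Lemma base_eq (x : subvs_of base) : vsval x = (base_iso x, 0).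
Proof.
rewrite base_isoE; case: x => -[v t] /= xP; congr (_, _).
by apply/eqP; rewrite -(memv_base (v, t)).
Qed.

Lemma base_iso_bij : bijective base_iso.
Proof.
apply: inj_lfun_bij => [|x x0]; first by rewrite -dim_base dimvf.
by apply: val_inj; rewrite /= base_eq x0.
Qed.

(** Moving along O changes only the second component, so, read in V, the projection from O is the
    first projection. *)
Lemma proj_apex (x : model) : base_iso (proj apex base x) = x.1.
Proof.
have cap0 : (base :&: <[apex]> = 0)%VS.
  apply/eqP; rewrite -subv0; apply/subvP => y.
  rewrite memv_cap memv0 memv_base => /andP[+ /vlineP[k yE]].
  by rewrite yE [_.2]mulr1 => /eqP ->; rewrite scale0r.
have full : x \in (base + <[apex]>)%VS.
  have -> : x = (x.1, 0) + x.2 *: apex.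
    case: x => v t; congr (_, _) => /=; first by rewrite scaler0 addr0.
    by rewrite add0r; symmetry; apply: mulr1.
  by rewrite memv_add ?memvZ ?memv_line // memv_base.
rewrite base_isoE comp_lfunE lfunE /= vsprojK ?memv_pi //.
rewrite -[in RHS](daddv_pi_add cap0 full).
have /vlineP[k ->] := memv_pi <[apex]>%VS base x.
by rewrite /= scaler0 addr0.
Qed.

Lemma vsval0 : vsval (0 : subvs_of (lker h)) = 0.
Proof. exact: linear0. Qed.

Lemma apexE : apex = (vsval (0 : subvs_of (lker h)) + 0 *: e, 1).
Proof. by rewrite vsval0 scale0r add0r. Qed.

(** * Geometry of the quadric c (h(v) t - q(v)) = 0 *)

Section ModelQuadric.
Variables (phi : bform model) (c : K).
Hypothesis c_neq0 : c != 0.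
Hypothesis phiE : forall x, quad phi x = c * (h x.1 * x.2 - cone_quad x.1).

Lemma quad_base u s t :
  quad phi (vsval u + s *: e, t) = c * (s * t - quad q u).
Proof. by rewrite phiE /= kernel_coord cone_quadE. Qed.

(** The direction of O involves only t, so the polar of O is the derivative in t of the equation. *)
Lemma polar_apex x : bapp phi apex x + bapp phi x apex = c * h x.1.
Proof.
rewrite polarE; case: x => v t; have [u ->] := kernel_split v; set s := h v.
have -> : apex + (vsval u + s *: e, t) = (vsval u + s *: e, 1 + t).
  by congr (_, _); rewrite /= add0r.
by rewrite apexE !quad_base /= kernel_coord /quad bapp0l; ring.
Qed.

Lemma apex_smooth : smooth_point phi apex.
Proof.
split.
- by apply: contraNneq apex_notin_base => ->; rewrite mem0v.
- by rewrite apexE quad_base /quad bapp0l; ring.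
(* The differential at O takes the value c at (e, 0), since h(e) = 1. *)
- apply: contraNneq c_neq0 => d0.
  have : Q_differential phi apex (e, 0) = 0 by rewrite d0 zero_lfunE.
  rewrite /Q_differential !add_lfunE -!/(bapp _ _ _) transposeE polar_apex /=.
  by rewrite he mulr1 => ->.
Qed.

Lemma Q_differential_apex x : Q_differential phi apex x = c * h x.1.
Proof.
by rewrite /Q_differential !add_lfunE -!/(bapp _ _ _) transposeE polar_apex.
Qed.

(** O and (e, 0) form a hyperbolic pair, and (u0, 0), with q(u0) nonzero, is orthogonal to both and
    not isotropic. The Gram matrix is thus invertible, and the images of these three vectors are
    independent. *)
Lemma rank_ge3 : (3 <= Q_rank phi)%N.
Proof.
have [u0 qu0] := symmetric_quad_neq0 char0 q_sym q_neq0.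
have two0 := two_neq0 char0.
pose E : model := (e, 0); pose U : model := (vsval u0, 0).
have [f fdef] : exists f : 'Hom(model, dual model),
    f = 2^-1 *: (phi + transpose phi) by eexists.
pose pol x y : K := (f x : 'Hom(model, K^o)) y.
have polE x y : pol x y = 2^-1 * (bapp phi x y + bapp phi y x).
  by rewrite /pol fdef !scale_lfunE !add_lfunE -!/(bapp _ _ _) transposeE.
have polC x y : pol x y = pol y x by rewrite !polE addrC.
have pol_self x : pol x x = quad phi x.
  rewrite polE; apply: (mulfI two0).
  by rewrite mulrA mulfV // mul1r /quad; ring.
have hu0 : h (vsval u0) = 0 by apply/eqP; rewrite -memv_ker subvsP.
have EE : E = (vsval (0 : subvs_of (lker h)) + 1 *: e, 0).
  by rewrite vsval0 scale1r add0r.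
have UE : U = (vsval u0 + 0 *: e, 0) by rewrite scale0r addr0.
have OO : pol apex apex = 0 by rewrite pol_self; have [] := apex_smooth.
have OE : pol apex E = 2^-1 * c by rewrite polE polar_apex /= he mulr1.
have OU : pol apex U = 0 by rewrite polE polar_apex /= hu0 !mulr0.
have pEE : pol E E = 0.
  by rewrite pol_self EE quad_base /quad bapp0l; ring.
have pUE : pol U E = 0.
  rewrite polE polarE [in _ + E]EE [in U + _]UE.
  have -> : (vsval u0 + 0 *: e, 0)
      + (vsval (0 : subvs_of (lker h)) + 1 *: e, 0) = (vsval u0 + 1 *: e, 0) :> model.
    by rewrite vsval0 scale0r addr0 add0r; congr (_, _); apply: addr0.
  rewrite EE UE !quad_base /quad bapp0l; ring.
have pUU : pol U U = - c * quad q u0.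
  by rewrite pol_self UE quad_base; ring.
have free3 : free [tuple f apex; f E; f U].
  apply/freeP => k; rewrite !big_ord_recl big_ord0 /= addr0 => sum0.
  have ev y : k ord0 * pol apex y + (k (lift ord0 ord0) * pol E y
      + k (lift ord0 (lift ord0 ord0)) * pol U y) = 0.
    have := congr1 (fun l : 'Hom(model, K^o) => l y) sum0.
    by rewrite !add_lfunE !scale_lfunE zero_lfunE.
  (* Evaluating the relation at [E], [apex] and [U] isolates the three coefficients in turn. *)
  have := ev E; rewrite OE pEE pUE !mulr0 !addr0 => /eqP.
  rewrite !mulf_eq0 invr_eq0 (negPf two0) (negPf c_neq0) !orbF => /eqP k0.
  have := ev apex; rewrite OO polC OE (polC U) OU !mulr0 add0r addr0 => /eqP.
  rewrite !mulf_eq0 invr_eq0 (negPf two0) (negPf c_neq0) !orbF => /eqP k1.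
  have := ev U; rewrite k0 k1 !mul0r !add0r pUU => /eqP.
  rewrite !mulf_eq0 oppr_eq0 (negPf qu0) (negPf c_neq0) !orbF => /eqP k2.
  by case=> -[|[|[|i]]] // lt_i;
    [rewrite -[RHS]k0 | rewrite -[RHS]k1 | rewrite -[RHS]k2]; congr (k _); apply: val_inj.
have := free3; rewrite /free /= => /eqP <-.
rewrite /Q_rank -fdef; apply/dimvS/span_subvP => l; rewrite !inE.
by move=> /or3P[] /eqP ->; apply: memv_img (memvf _).
Qed.

(** At (v, 0) the quadratic form is - c q(v) and the polar of O is c h(v), so both terms of [eta]
    carry the factor - c. *)
Lemma eta_apex (x : subvs_of base) :
  eta phi apex x = - c *: evaluation_point (base_iso x).
Proof.
rewrite /eta polar_apex phiE base_eq /=; set v := base_iso x.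
rewrite mulr0 sub0r; congr (_, _) => /=.
  by rewrite scaler0 sub0r scalerA mulNr scaleNr.
by rewrite scaler0 subr0 [LHS]mulr1 mulrN -mulNr.
Qed.

(** On T_O, where h = 0, the equation reduces to - c q(v), free of t: this is the cone over C0 with
    vertex O. *)
Lemma tangent_section_apex (dimH : (\dim (lker h)).+1 = \dim {:V}) :
  is_projected_tangent_section phi apex base_iso (HQuadric dimH q_sym q_neq0).
Proof.
have tan x : (x \in tangent_hyperplane phi apex) = (h x.1 == 0).
  by rewrite memv_ker Q_differential_apex mulf_eq0 (negPf c_neq0).
split=> /=.
  apply/vspaceP => v; apply/idP/idP.
    case/memv_imgP => _ /memv_imgP[x xT ->] ->.
    by rewrite proj_apex memv_ker -tan.
  rewrite memv_ker => hv; rewrite -[v]/((v, 0) : model).1 -proj_apex.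
  by rewrite !memv_img // tan.
exists (- c^-1) => [|x]; first by rewrite oppr_eq0 invr_eq0.
have /eqP hx : h (vsval x).1 == 0 by rewrite -tan subvsP.
rewrite proj_apex phiE /cone_quad hx scale0r subr0 mul0r sub0r.
by rewrite !mulrN mulNr opprK mulKf.
Qed.

End ModelQuadric.

End Model.

(** * From the congruence to the form [phi] *)

Lemma linear_form_homog (K : fieldType) (E : vectType K) (l : 'Hom(E, K^o)) :
  homog_map 1 (fun x => l x : K^o).
Proof.
exists (fun x : {ffun 'I_1 -> E} => l (x ord0) : K^o) => [x i a u v|v].
  by rewrite !ffunE (ord1 i) eqxx linearP.
by rewrite ffunE.
Qed.

(** The whole construction over a field of characteristic 0, where polarization and root counting
    are available. *)
Lemma normal_congruence_by_projection (K : fieldType)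
    (char0 : [pchar K] =i pred0) (V : vectType K) (C0 : hquadric V)
    (W0 : {vspace bform V}) (normalW0 : is_normal_space C0 W0)
    (sigma : ratmap V (subvs_of W0))
    (sigma_qc : quadratic_congruence sigma)
    (sigma_nanti : ~ antisymmetric_pullback sigma) :
  exists (W : vectType K) (phi : bform W) (O : W) (P : {vspace W})
    (iota : 'Hom(subvs_of P, V)),
    [/\ \dim {:W} = (\dim {:V}).+1,
        bijective (phi : 'Hom(W, dual W)),
        (3 <= Q_rank phi)%N &
        smooth_point phi O]
    /\ [/\ \dim P = \dim {:V},
        O \notin P,
        bijective iota,
        is_projected_tangent_section phi O iota C0 &
        generically (fun Q : subvs_of P =>
          sigma (iota Q) != 0 /\
          is_S phi O (perp phi (eta phi O Q))
            (fun x : subvs_of P => quad (vsval (sigma (iota Q))) (iota x)))].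
Proof.
case: C0 normalW0 => H q dimH q_sym q_neq0 normalW0.
have [h [e [he HE]]] := hyperplane_kernel dimH.
subst H.
case: sigma_qc => W0_sym dimW0 _ [theta thetaE theta_bij] incident.
have W0_q b : b \in W0 -> exists c, forall u : subvs_of (lker h),
    quad b (vsval u) = c * quad q u.
  by move=> bW; have [] := (normalW0 b).1 bW.
have [lam lam_bij lamE] :=
  normal_space_duality char0 he q_sym q_neq0 W0_sym W0_q dimW0.
have [lam' lam'K lamK] := lam_bij; have [theta' theta'K thetaK] := theta_bij.
pose B (x y : model V) : K^o := (lam x : 'Hom(_, K^o)) (theta (lam y)).
have Bl y : linear (B^~ y).
  by move=> a x x'; rewrite /B linearP add_lfunE scale_lfunE.
have Br x : linear (B x) by move=> a y y'; rewrite /B !linearP.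
have [phi bappP] : exists phi : bform (model V), forall x y,
    bapp phi x y = (lam x : 'Hom(_, K^o)) (theta (lam y)) by exact: bilinear_hom.
(* Evaluating the quadric theta(l) at v gives l(sigma(v)); here l is the evaluation at v'. *)
have sigmaE v v' :
    bapp phi (evaluation_point e q v) (evaluation_point e q v')
    = quad (vsval (sigma v)) v'.
  by rewrite bappP lamE thetaE lamE.
have [c cE] : exists c : K, forall x : model V,
    quad phi x = c * (h x.1 * x.2 - cone_quad e q x.1).
  apply: (quad_of_evaluation_points char0 he q_sym q_neq0) => v.
  (* Incidence is assumed only where sigma(v) is nonzero; elsewhere the equation is the zero
     form. *)
  rewrite /quad sigmaE; have [->|/incident//] := eqVneq (sigma v) 0.
  by rewrite /quad /bapp linear0 !zero_lfunE.
have c_neq0 : c != 0.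
  (* If c = 0, then [phi] is alternating, and [theta], recovered through [lam'], is
     antisymmetric. *)
  apply: contra_notN sigma_nanti => /eqP c0; exists theta => // l m.
  have : bapp phi (lam' l) (lam' m) + bapp phi (lam' m) (lam' l) = 0.
    by rewrite polarE !cE c0 !mul0r !subr0.
  by rewrite !bappP !lamK => /eqP; rewrite addr_eq0 => /eqP.
(* Every element of W0 is theta(lam(y)) for some y, so phi(x) = 0 makes lam(x) vanish on W0. *)
have phi_inj x : (phi : 'Hom(model V, dual (model V))) x = 0 -> x = 0.
  move=> phix0; apply: (can_inj lam'K); rewrite linear0.
  apply/lfunP => w; rewrite zero_lfunE -(thetaK w) -(lamK (theta' w)) -bappP.
  by rewrite /bapp phix0 zero_lfunE.
have etaE Q := eta_apex he cE Q.
exists (model V), phi, (apex V), (base V), (base_iso V); split; split.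
- exact: dim_model.
- by apply: inj_lfun_bij => //; rewrite dim_dual.
- exact: (rank_ge3 char0 he q_sym q_neq0 c_neq0 cE).
- exact: (apex_smooth he c_neq0 cE).
- exact: dim_base.
- exact: apex_notin_base.
- exact: base_iso_bij.
- exact: (tangent_section_apex he q_sym q_neq0 c_neq0 cE dimH).
(* The general points are those off the hyperplane of C0; there h(v) v is nonzero, hence so is the
   evaluation point, and sigma is defined. *)
exists 1%N, (fun Q => (h \o base_iso V)%VF Q); split.
- exact: linear_form_homog.
- have [iota' _ iotaK] := base_iso_bij V.
  by exists (iota' e); rewrite comp_lfunE iotaK he oner_eq0.
move=> Q _; rewrite comp_lfunE; set v := base_iso V Q => hv.
have ev_neq0 : evaluation_point e q v != 0.
  apply: contraNneq hv => /(congr1 fst) /= /eqP; rewrite scaler_eq0.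
  by case/orP => /eqP -> //; rewrite linear0.
have sigma_neq0 : sigma v != 0.
  apply: contraNneq ev_neq0 => sv0; apply/eqP/phi_inj; apply/lfunP => y.
  rewrite zero_lfunE -/(bapp phi _ y) bappP lamE thetaE sv0.
  by rewrite linear0.
split => //.
exists ((phi : 'Hom(model V, dual (model V))) (eta phi (apex V) Q)).
split => //.
  apply: contraNneq ev_neq0 => /phi_inj /eqP.
  by rewrite etaE scaler_eq0 oppr_eq0 (negPf c_neq0).
(* Each of the two occurrences of [eta] contributes a factor - c. *)
exists (c ^- 2) => [|Q']; first by rewrite invr_eq0 expf_neq0.
rewrite -/(bapp phi _ _) !etaE bappZl bappZr sigmaE mulrA mulrNN -expr2.
by rewrite mulKf ?expf_neq0.
Qed.

Theorem mainTheorem3 (R : realType) (n : nat) (n_ge3 : (3 <= n)%N)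
    (V : vectType R[i]) (dimV : \dim {:V} = n)
    (C0 : hquadric V)
    (W0 : {vspace bform V}) (normalW0 : is_normal_space C0 W0)
    (sigma : ratmap V (subvs_of W0))
    (sigma_qc : quadratic_congruence sigma)
    (sigma_nanti : ~ antisymmetric_pullback sigma) :
  exists (W : vectType R[i]) (phi : bform W) (O : W) (P : {vspace W})
    (iota : 'Hom(subvs_of P, V)),
    [/\ \dim {:W} = n.+1,
        bijective (phi : 'Hom(W, dual W)),
        (3 <= Q_rank phi)%N &
        smooth_point phi O]
    /\ [/\ \dim P = n,
        O \notin P,
        bijective iota,
        is_projected_tangent_section phi O iota C0 &
        generically (fun Q : subvs_of P =>
          sigma (iota Q) != 0 /\
          is_S phi O (perp phi (eta phi O Q))
            (fun x : subvs_of P => quad (vsval (sigma (iota Q))) (iota x)))].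
Proof.
rewrite -dimV.
exact: (normal_congruence_by_projection (Num.Theory.pchar_num R[i]) normalW0
  sigma_qc sigma_nanti).
Qed.
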